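(* Let $n\ge 2$ be an integer and let $f:\mathbb{Z}/n\mathbb{Z}\to\mathbb{Z}/n\mathbb{Z}$. The following conditions are equivalent: (1) $f$ is congruence preserving, i.e. for all $x,y\in\mathbb{Z}/n\mathbb{Z}$ there exists $d\in\mathbb{Z}/n\mathbb{Z}$ with $f(x)-f(y)=d(x-y)$; (2) there exists a function $F:\mathbb{N}\to\mathbb{N}$ which is congruence preserving (i.e. for all $a,b\in\mathbb{N}$, $a-b$ divides $F(a)-F(b)$ in $\mathbb{Z}$) and which satisfies $\pi_n\circ F=f\circ\pi_n$ on $\mathbb{N}$.
   Context: For an integer $k\ge1$, $\pi_k:\mathbb{Z}\to\mathbb{Z}/k\mathbb{Z}$ denotes the canonical surjective ring homomorphism (here applied to elements of $\mathbb{N}\subseteq\mathbb{Z}$). *)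

(* Defs.v *)
From HB Require Import structures.
From mathcomp Require Import all_boot all_order all_algebra.

Set Implicit Arguments.
Unset Strict Implicit.
Unset Printing Implicit Defensive.

Import GRing.Theory.
Local Open Scope ring_scope.

(* ['Z_k] is the ring of integers mod k only for 1 < k: ['Z_0] and ['Z_1]
   both denote the integers mod 2. *)
Definition Zn_proj (k : nat) (z : int) : 'Z_k := z%:~R.

Definition Zn_congruence_preserving (n : nat) (f : 'Z_n -> 'Z_n) : Prop :=
  forall x y : 'Z_n, exists d : 'Z_n, f x - f y = d * (x - y).

(* The differences are taken in [int], since subtraction in [nat] is truncated. *)
Definition nat_congruence_preserving (F : nat -> nat) : Prop :=
  forall a b : nat, ((a%:Z - b%:Z)%R %| ((F a)%:Z - (F b)%:Z)%R)%Z.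

(* Main.v *)
(** The values of F are built one at a time. Given F(0), ..., F(m-1), the value
    F(m) must satisfy F(m) = F(i) modulo m - i for all i < m, and F(m) = f(m)
    modulo n. By the Chinese remainder theorem for non-coprime moduli, this
    system is solvable as soon as its congruences are pairwise compatible:
    F(i) = F(j) modulo gcd(m-i, m-j) since this gcd divides i - j, and
    F(i) = f(i) = f(m) modulo gcd(m-i, n) since f is congruence preserving. *)

Require Import Defs.
From mathcomp Require Import all_boot all_order all_algebra.
From mathcomp Require Import ring.

Set Implicit Arguments.
Unset Strict Implicit.
Unset Printing Implicit Defensive.

Import GRing.Theory Num.Theory.
Local Open Scope ring_scope.

Lemma gcdn_lcmr (m n p : nat) :
  gcdn m (lcmn n p) = lcmn (gcdn m n) (gcdn m p).
Proof. exact: (@Order.DistrLatticeTheory.meetUr _ natdvd). Qed.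

Lemma dvdz_gcd_lcmr (m n p x : int) :
  (gcdz m n %| x)%Z -> (gcdz m p %| x)%Z -> (gcdz m (lcmz n p) %| x)%Z.
Proof.
by rewrite /gcdz /lcmz !dvdzE !absz_nat gcdn_lcmr dvdn_lcm => -> ->.
Qed.

(** By Bezout, [a - b] equals [k * (u * m + v * n)], so [a - k * u * m] and [b + k * v * n] are the
    same integer. *)
Lemma chinese_gcd (m n a b : int) :
  (gcdz m n %| a - b)%Z -> {x | (m %| x - a)%Z & (n %| x - b)%Z}.
Proof.
move=> /dvdzP/sig_eqW [k def_ab]; have [u [v def_g]] := Bezoutz m n.
exists (a - k * u * m).
  by rewrite addrAC subrr add0r -mulNr dvdz_mull.
have -> : a - k * u * m - b = k * v * n; last exact: dvdz_mull.
by rewrite addrAC def_ab -def_g; ring.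
Qed.

(** Induction on [s]: the moduli of the tail are merged into their lcm [M], and the case of two
    moduli applies to [m i] and [M]. Since gcd distributes over lcm, compatibility with [M] reduces
    to compatibility with each [m j]. *)
Lemma chinese_pairwise (I : eqType) (s : seq I) (m a : I -> int) :
  {in s &, forall i j, (gcdz (m i) (m j) %| a i - a j)%Z} ->
  {x | {in s, forall i, (m i %| x - a i)%Z}}.
Proof.
elim: s => [|i s IHs] compat; first by exists 0.
have [|x xP] := IHs.
  by move=> j k js ks; apply: compat; rewrite inE ?js ?ks orbT.
pose M := \big[lcmz/1]_(j <- s) m j.
have dvd_M j : j \in s -> (m j %| M)%Z.
  rewrite /M; elim: (s) => // k t IHt; rewrite big_cons inE.
  case/predU1P => [->|/IHt]; first exact: dvdz_lcml.
  by move/dvdz_trans; apply; exact: dvdz_lcmr.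
have gM : (gcdz (m i) M %| a i - x)%Z.
  (* Modulo this gcd, [a i] agrees with [a j] by hypothesis, and [a j] with [x] because [x] solves
     the tail. *)
  have gm j : j \in s -> (gcdz (m i) (m j) %| a i - x)%Z.
    move=> js; rewrite -(subrKA (a j)) rpredD //.
      by apply: compat; rewrite inE ?eqxx ?js ?orbT.
    by rewrite -opprB rpredN (dvdz_trans (dvdz_gcdr _ _)) ?xP.
  rewrite /M big_seq; apply: (big_ind (fun z => (gcdz (m i) z %| a i - x)%Z)) => //.
    by rewrite gcdz1 dvd1z.
  by move=> y z; exact: dvdz_gcd_lcmr.
have [y yi yM] := chinese_gcd gM; exists y => j; rewrite inE.
case/predU1P=> [->//|js]; rewrite -(subrKA x) rpredD ?xP //.
exact: dvdz_trans (dvd_M j js) yM.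
Qed.

(** Reducing an integer solution modulo the product of the moduli keeps every congruence. This
    product is nonzero, so the remainder is nonnegative. *)
Lemma chinese_pairwise_nat (I : eqType) (s : seq I) (m a : I -> int) :
  {in s, forall i, m i != 0} ->
  {in s &, forall i j, (gcdz (m i) (m j) %| a i - a j)%Z} ->
  {x : nat | {in s, forall i, (m i %| x%:Z - a i)%Z}}.
Proof.
move=> m_neq0 /chinese_pairwise[x xP]; pose M := \prod_(i <- s) m i.
have M_neq0 : M != 0 by rewrite /M prodf_seq_neq0; apply/allP => i /m_neq0.
exists `|(x %% M)%Z|%N => i si; rewrite gez0_abs ?modz_ge0 //.
have -> : (x %% M)%Z - a i = (x - a i) - (x %/ M)%Z * M.
  by rewrite [X in X - a i - _](divz_eq x M); ring.
by rewrite rpredB ?xP // dvdz_mull // /M (big_rem i) //= dvdz_mulr.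
Qed.

(** Recursion on the whole prefix of earlier values. The extension hypothesis is a sigma type, hence
    a function of the prefix and its proof, and iterating it defines [F] without a choice axiom. *)
Lemma exists_mkseq (T : Type) (P : seq T -> Prop) :
  P [::] -> (forall s, P s -> {x | P (rcons s x)}) ->
  exists F : nat -> T, forall m, P (mkseq F m).
Proof.
move=> P0 PS; pose step (s : {s | P s}) : {s | P s} :=
  let: exist x Px := PS (sval s) (svalP s) in exist _ (rcons (sval s) x) Px.
pose G m := iter m step (exist _ [::] P0).
pose F m := sval (PS (sval (G m)) (svalP (G m))).
have GE m : sval (G m) = mkseq F m.
  elim: m => // m IHm; rewrite mkseqS -IHm /F.
  by rewrite [G m.+1]/(step (G m)) /step; case: (PS _ _).
by exists F => m; rewrite -GE; exact: svalP.
Qed.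

Lemma Zn_proj_eq0 (n : nat) (z : int) :
  (1 < n)%N -> (Zn_proj n z == 0) = (n %| z)%Z.
Proof.
have natE k : (1 < n)%N -> ((k%:R : 'Z_n) == 0) = (n %| k)%N.
  by move=> n_gt1; rewrite -val_eqE /= val_Zp_nat.
move=> n_gt1; rewrite /Zn_proj dvdzE absz_nat; case: z => k; first exact: natE.
by rewrite NegzE mulrNz oppr_eq0 abszN absz_nat; exact: natE.
Qed.

Lemma Zn_projB_eq (n : nat) (y z : int) :
  (1 < n)%N -> Zn_proj n y = Zn_proj n z <-> (n %| y - z)%Z.
Proof.
move=> n_gt1; rewrite -Zn_proj_eq0 // /Zn_proj rmorphB subr_eq0.
by split=> /eqP.
Qed.

Lemma Zn_proj_val (n : nat) (x : 'Z_n) : Zn_proj n (x : nat)%:Z = x.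
Proof. exact: natr_Zp. Qed.

(** Lifting [d] to an integer makes [p - q] congruent modulo [n] to a multiple of [a - b], and the
    gcd divides both [n] and [a - b]. *)
Lemma Zn_congruence_preserving_gcd (n : nat) (f : 'Z_n -> 'Z_n) (a b p q : int) :
  (1 < n)%N -> Zn_congruence_preserving f ->
  Zn_proj n p = f (Zn_proj n a) -> Zn_proj n q = f (Zn_proj n b) ->
  (gcdz (a - b) n %| p - q)%Z.
Proof.
move=> n_gt1 fP pE qE; have [d] := fP (Zn_proj n a) (Zn_proj n b).
rewrite -pE -qE -{1}(Zn_proj_val d) /Zn_proj -!rmorphB -rmorphM.
move/(Zn_projB_eq _ _ n_gt1); set e := _%:Z => /(dvdz_trans (dvdz_gcdr (a - b) n)).
by rewrite rpredBr // dvdz_mull ?dvdz_gcdl.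
Qed.

Lemma congruence_lift_exists (n : nat) (f : 'Z_n -> 'Z_n) :
  (1 < n)%N -> Zn_congruence_preserving f ->
  exists F : nat -> nat,
    nat_congruence_preserving F /\
    (forall a : nat, Zn_proj n (Posz (F a)) = f (Zn_proj n (Posz a))).
Proof.
move=> n_gt1 fP.
pose lift s := forall i, (i < size s)%N ->
  Zn_proj n (nth 0%N s i)%:Z = f (Zn_proj n i%:Z).
pose cong s := forall i j, (i < size s)%N -> (j < size s)%N ->
  (i%:Z - j%:Z %| (nth 0%N s i)%:Z - (nth 0%N s j)%:Z)%Z.
have [//|s [sL sC]|F FP] := @exists_mkseq nat (fun s => lift s /\ cong s).
  pose m := size s.
  (* The index [m] carries the congruence modulo [n]. *)
  pose md i : int := if (i < m)%N then m%:Z - i%:Z else n.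
  pose a i : int := if (i < m)%N then (nth 0%N s i)%:Z
                    else (f (Zn_proj n m) : nat)%:Z.
  (* Since [a m] represents the value of [f] at [m], one formula covers old and new indices, as the
     compatibility with modulus [n] requires. *)
  have aL i : (i <= m)%N -> Zn_proj n (a i) = f (Zn_proj n i).
    rewrite leq_eqVlt /a => /predU1P [->|lt_im]; last by rewrite lt_im sL.
    by rewrite ltnn Zn_proj_val.
  have am i : (i < m)%N -> (gcdz (md i) n %| a i - a m)%Z.
    move=> lt_im; rewrite /md lt_im -opprB rpredN.
    by apply: (Zn_congruence_preserving_gcd n_gt1 fP); rewrite aL // ltnW.
  have [||x xP] := @chinese_pairwise_nat _ (iota 0 m.+1) md a.
  - move=> i _; rewrite /md; case: ifP => [lt_im|_]; last by rewrite -lt0n ltnW.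
    by rewrite subr_eq0 eqz_nat gtn_eqF.
  - move=> i j; rewrite !mem_iota !add0n /= !ltnS.
    rewrite [(i <= m)%N]leq_eqVlt [(j <= m)%N]leq_eqVlt.
    have mdm : md m = n by rewrite /md ltnn.
    case/predU1P=> [->|lt_im] /predU1P [->|lt_jm]; rewrite ?mdm.
    + by rewrite subrr dvdz0.
    + by rewrite gcdzC -opprB rpredN am.
    + exact: am.
    rewrite /md /a lt_im lt_jm; apply: dvdz_trans (sC i j lt_im lt_jm).
    have -> : i%:Z - j%:Z = (m%:Z - j%:Z) - (m%:Z - i%:Z) by ring.
    by rewrite rpredB ?dvdz_gcdl ?dvdz_gcdr.
  have xi i : (i < m)%N -> (m%:Z - i%:Z %| x%:Z - (nth 0%N s i)%:Z)%Z.
    move=> lt_im; have := xP i.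
    by rewrite mem_iota ltnS (ltnW lt_im) /md /a lt_im; apply.
  have xm : Zn_proj n x = f (Zn_proj n m).
    rewrite -(aL m) //; apply/Zn_projB_eq => //.
    by have := xP m; rewrite mem_iota add0n /md !ltnn; apply => /=.
  exists x; split=> [i|i j]; rewrite size_rcons -/m ltnS [(i <= m)%N]leq_eqVlt.
    case/predU1P=> [->|lt_im]; rewrite nth_rcons -/m ?ltnn ?eqxx //.
    by rewrite lt_im sL.
  rewrite ltnS [(j <= m)%N]leq_eqVlt.
  case/predU1P=> [->|lt_im] /predU1P [->|lt_jm];
    rewrite !nth_rcons -/m ?ltnn ?eqxx ?lt_im ?lt_jm ?subrr ?dvdz0 //.
  - exact: xi.
  (* The new index is on the right here: negating both sides reduces to [xi]. *)
  - by rewrite dvdzE -abszN -[X in (_ %| X)%N]abszN !opprB; exact: xi.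
  - exact: sC.
exists F; split=> [a b|a].
  (* The prefix of length [(maxn a b).+1] contains both indices. *)
  have a_lt : (a < (maxn a b).+1)%N by rewrite ltnS leq_maxl.
  have b_lt : (b < (maxn a b).+1)%N by rewrite ltnS leq_maxr.
  have [_ /(_ a b)] := FP (maxn a b).+1.
  by rewrite size_mkseq !nth_mkseq //; apply.
by have [/(_ a) + _] := FP a.+1; rewrite size_mkseq nth_mkseq //; apply.
Qed.

Theorem theorem5 (n : nat) (hn : (2 <= n)%N) (f : 'Z_n -> 'Z_n) :
  Zn_congruence_preserving f <->
  exists F : nat -> nat,
    nat_congruence_preserving F /\
    (forall a : nat, Zn_proj n (Posz (F a)) = f (Zn_proj n (Posz a))).
Proof.
split=> [|[F [FC FL]] x y]; first exact: congruence_lift_exists.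
(* [FC] is applied to the natural representatives of [x] and [y]; the integer quotient [k] projects
   to the required multiplier. *)
have /dvdzP[k Fxy] := FC x y; exists (Zn_proj n k).
rewrite -[in LHS](Zn_proj_val x) -[in LHS](Zn_proj_val y) -!FL.
rewrite -[in RHS](Zn_proj_val x) -[in RHS](Zn_proj_val y).
by rewrite /Zn_proj -!rmorphB -rmorphM Fxy.
Qed.
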